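(* Let $m,n,r$ be positive integers and let $(A,B)$ be a locally rigid size-$r$ nonnegative factorization, where $A\in\mathbb{R}^{m\times r}_{\ge 0}$, $B\in\mathbb{R}^{r\times n}_{\ge 0}$ and $\operatorname{rank}(AB)=r$. Then there exist a matrix $A'$ obtained from $A$ by adding at most $r$ strictly positive rows and a matrix $B'$ obtained from $B$ by adding at most $r$ strictly positive columns such that $(A',B')$ is a globally rigid nonnegative factorization.
   Context: Inequalities between matrices are entrywise. A size-$r$ nonnegative factorization of a matrix $M$ is a pair $(\tilde A,\tilde B)$ of entrywise nonnegative matrices with $\tilde A\tilde B=M$, where $\tilde A$ has $r$ columns and $\tilde B$ has $r$ rows. A size-$r$ nonnegative factorization $(A,B)$ is locally rigid if there is a neighborhood of $(A,B)$ in $\mathbb{R}^{m\times r}\times\mathbb{R}^{r\times n}$ such that every size-$r$ nonnegative factorization of $AB$ in that neighborhood is obtained by scaling the columns of $A$ and rows of $B$, i.e. is of the form $(A\Lambda,\Lambda^{-1}B)$ for a diagonal matrix $\Lambda$ with positive diagonal entries. A size-$r$ nonnegative factorization $(A,B)$ is globally rigid if every size-$r$ nonnegative factorization of $AB$ is obtained by scaling and permuting the columns of $A$ and rows of $B$, i.e. is of the form $(AP,P^{-1}B)$ with $P$ the product of an $r\times r$ permutation matrix and a diagonal matrix with positive diagonal entries. *)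

(* Defs.v *)
From HB Require Import structures.
From mathcomp Require Import all_boot all_order all_algebra all_fingroup.
From mathcomp Require Import all_classical all_reals all_analysis.

Set Implicit Arguments.
Unset Strict Implicit.
Unset Printing Implicit Defensive.

Import Order.TTheory GRing.Theory Num.Theory.
Import numFieldNormedType.Exports.

Local Open Scope classical_set_scope.
Local Open Scope ring_scope.

Definition nonneg_factorization (R : realType) (m n r : nat) (M : 'M[R]_(m, n))
    (A : 'M[R]_(m, r)) (B : 'M[R]_(r, n)) : Prop :=
  [/\ A \is a mxOver Num.nneg, B \is a mxOver Num.nneg & A *m B = M].

Definition scaling_mx (R : realType) (r : nat) (L : 'M[R]_r) : Prop :=
  exists2 d : 'rV[R]_r, d \is a mxOver Num.pos & L = diag_mx d.

Definition scaled_perm_mx (R : realType) (r : nat) (P : 'M[R]_r) : Prop :=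
  exists (s : 'S_r) (L : 'M[R]_r), scaling_mx L /\ P = perm_mx s *m L.

(* The neighborhood is taken in the product topology on
   'M[R]_(m, r) * 'M[R]_(r, n), i.e. the Euclidean one. *)
Definition locally_rigid (R : realType) (m n r : nat)
    (A : 'M[R]_(m, r)) (B : 'M[R]_(r, n)) : Prop :=
  nonneg_factorization (A *m B) A B /\
  \forall X \near A & Y \near B, nonneg_factorization (A *m B) X Y ->
    exists L : 'M[R]_r, [/\ scaling_mx L, X = A *m L & Y = invmx L *m B].

Definition globally_rigid (R : realType) (m n r : nat)
    (A : 'M[R]_(m, r)) (B : 'M[R]_(r, n)) : Prop :=
  nonneg_factorization (A *m B) A B /\
  forall (X : 'M[R]_(m, r)) (Y : 'M[R]_(r, n)),
    nonneg_factorization (A *m B) X Y ->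
    exists P : 'M[R]_r, [/\ scaled_perm_mx P, X = A *m P & Y = invmx P *m B].

(* Main.v *)
Require Import Defs.
From HB Require Import structures.
From mathcomp Require Import all_boot all_order all_algebra all_fingroup.
From mathcomp Require Import all_classical all_reals all_analysis.
From mathcomp Require Import ring lra.

Set Implicit Arguments.
Unset Strict Implicit.
Unset Printing Implicit Defensive.

Import Order.TTheory GRing.Theory Num.Theory.
Import numFieldNormedType.Exports.

Local Open Scope classical_set_scope.
Local Open Scope ring_scope.

(** Write A' for [A; C] and B' for [B D], where C = D = 1 + eps J with J the
    all-ones matrix and eps small: these are r strictly positive rows and
    columns, generating cones only slightly smaller than the nonnegative
    orthant.

    Since C and D are invertible, every size-r factorization of A' B' has the
    form (A' S, S^-1 B') for an invertible S ([factorization_bordered]), and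
    it is nonnegative only if C S and S^-1 D are.  These two conditions say
    that S and S^-1 have no very negative entry relative to the sums of their
    columns, resp. rows.  For eps = 0 they would say that S and S^-1 are
    nonnegative, that is, that S is a scaled permutation matrix.  The
    quantitative version is [near_scaled_perm]: S = U P with P a scaled
    permutation matrix and U as close to the identity as desired, uniformly
    in S.  Uniformity is the point that needs care, because S^-1 could a
    priori be unbounded; but once the column sums of S are normalized to 1,
    the column sums of S^-1 are 1 too, so its nonnegative row sums add up to
    r ([stochastic_near_perm]).

    Then (A U, U^-1 B) is a nonnegative factorization of A B close to (A, B),
    because A U = (A S) P^-1 and P^-1 is nonnegative.  Local rigidity
    ([locally_rigid_basis]) gives A U = A L with L a positive diagonal matrix;
    A has full column rank, so U = L and S = L P is a scaled permutation
    matrix. *)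

(** * Entrywise bounds and signs of matrices *)

Lemma sumr_ord_le (R : realType) (r : nat) (Q : pred 'I_r) (F : 'I_r -> R)
    (c : R) :
  0 <= c -> (forall i, Q i -> F i <= c) ->
  \sum_(i < r | Q i) F i <= r%:R * c.
Proof.
move=> c_ge0 Fc; rewrite big_mkcond /=.
apply: (@le_trans _ _ (\sum_(i < r) c)).
  by apply: ler_sum => i _; case: ifP => [/Fc|].
by rewrite sumr_const card_ord mulr_natl.
Qed.

(** The weights F i may be negative, but a lower bound relative to their own
    total prevents the total from being negative: summing the bounds gives
    (1 + r eps) * total >= 0. *)
Lemma sumr_ge0_relative (R : realType) (r : nat) (eps : R) (F : 'I_r -> R) :
  0 <= eps -> (forall i, - (eps * \sum_k F k) <= F i) -> 0 <= \sum_k F k.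
Proof.
move=> eps_ge0 F_ge; set t := \sum_k F k.
have : - t <= r%:R * (eps * t).
  rewrite -sumrN; apply: le_trans (_ : \sum_(k < r) eps * t <= _).
    by apply: ler_sum => k _; rewrite lerNl; apply: F_ge.
  by rewrite sumr_const card_ord mulr_natl.
rewrite mulrA -subr_ge0 opprK -[X in _ + X]mul1r -mulrDl pmulr_rge0 //.
by rewrite ltr_wpDl // !mulr_ge0.
Qed.

Lemma norm_entry_le (R : realType) (m n : nat) (M : 'M[R]_(m, n)) i j :
  `|M i j| <= `|M|.
Proof.
rewrite [leRHS]/Num.Def.normr /= mx_normrE; apply/bigmax_geP; right.
by exists (i, j).
Qed.

Lemma mx_norm_le (R : realType) (m n : nat) (M : 'M[R]_(m, n)) (c : R) :
  0 <= c -> (forall i j, `|M i j| <= c) -> `|M| <= c.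
Proof.
move=> c_ge0 Mc; rewrite [leLHS]/Num.Def.normr /= mx_normrE.
by apply: bigmax_le => // ij _; apply: Mc.
Qed.

Lemma mx_norm_mulmx (R : realType) (m p n : nat) (M : 'M[R]_(m, p))
    (N : 'M[R]_(p, n)) :
  `|M *m N| <= p%:R * (`|M| * `|N|).
Proof.
apply: mx_norm_le => [|i j]; first by rewrite !mulr_ge0.
rewrite mxE; apply: le_trans (ler_norm_sum _ _ _) _.
apply: sumr_ord_le => [|k _]; first by rewrite mulr_ge0.
by rewrite normrM ler_pM // norm_entry_le.
Qed.

Lemma nneg_mxE (R : realType) (m n : nat) (M : 'M[R]_(m, n)) :
  (M \is a mxOver Num.nneg) <-> (forall i j, 0 <= M i j).
Proof. by split=> [/mxOverP M0 i j|M0]; [|apply/mxOverP=> i j]; apply: M0. Qed.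

Lemma pos_mxE (R : realType) (m n : nat) (M : 'M[R]_(m, n)) :
  (M \is a mxOver Num.pos) <-> (forall i j, 0 < M i j).
Proof. by split=> [/mxOverP M0 i j|M0]; [|apply/mxOverP=> i j]; apply: M0. Qed.

Lemma pos_mx_nneg (R : realType) (m n : nat) (M : 'M[R]_(m, n)) :
  M \is a mxOver Num.pos -> M \is a mxOver Num.nneg.
Proof. by move=> /pos_mxE M_gt0; apply/nneg_mxE => i j; apply: ltW. Qed.

Lemma nneg_col_mx (R : realType) (m1 m2 n : nat) (M1 : 'M[R]_(m1, n))
    (M2 : 'M[R]_(m2, n)) :
  (col_mx M1 M2 \is a mxOver Num.nneg) =
  (M1 \is a mxOver Num.nneg) && (M2 \is a mxOver Num.nneg).
Proof.
apply/idP/andP => [/nneg_mxE M0|[/nneg_mxE M10 /nneg_mxE M20]].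
  split; apply/nneg_mxE => i j.
    by have := M0 (lshift m2 i) j; rewrite col_mxEu.
  by have := M0 (rshift m1 i) j; rewrite col_mxEd.
by apply/nneg_mxE => i j; rewrite mxE; case: (fintype.split i).
Qed.

Lemma nneg_row_mx (R : realType) (m n1 n2 : nat) (M1 : 'M[R]_(m, n1))
    (M2 : 'M[R]_(m, n2)) :
  (row_mx M1 M2 \is a mxOver Num.nneg) =
  (M1 \is a mxOver Num.nneg) && (M2 \is a mxOver Num.nneg).
Proof.
apply/idP/andP => [/nneg_mxE M0|[/nneg_mxE M10 /nneg_mxE M20]].
  split; apply/nneg_mxE => i j.
    by have := M0 i (lshift n2 j); rewrite row_mxEl.
  by have := M0 i (rshift n1 j); rewrite row_mxEr.
by apply/nneg_mxE => i j; rewrite mxE; case: (fintype.split j).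
Qed.

(** * Scaled permutation matrices *)

(** The scaling is moved across the permutation matrix by permuting its
    diagonal entries. *)
Lemma scaling_mul_scaled_perm (R : realType) (r : nat) (L P : 'M[R]_r) :
  scaling_mx L -> scaled_perm_mx P -> scaled_perm_mx (L *m P).
Proof.
case=> d /pos_mxE d_gt0 -> [s [_ [[e /pos_mxE e_gt0 ->] ->]]].
exists s, (diag_mx (\row_j (d 0 (s^-1%g j) * e 0 j))); split.
  by eexists; last by []; apply/pos_mxE=> i j; rewrite mxE mulr_gt0.
rewrite !mulmxA mul_diag_mx !mul_mx_diag; apply/matrixP=> i j; rewrite !mxE.
by have [<-|] := eqVneq (s i) j; rewrite ?permK ?mulr0 ?mul0r //; ring.
Qed.

Lemma scaled_perm_mxV (R : realType) (r : nat) (P : 'M[R]_r) :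
  scaled_perm_mx P -> exists2 Q, scaled_perm_mx Q & Q *m P = 1%:M.
Proof.
case=> s [_ [[d /pos_mxE d_gt0 ->] ->]].
have dV : scaling_mx (diag_mx (\row_j (d 0 j)^-1)).
  by eexists; last by []; apply/pos_mxE=> i j; rewrite mxE invr_gt0.
exists (diag_mx (\row_j (d 0 j)^-1) *m (perm_mx s^-1 *m 1%:M)).
  apply: scaling_mul_scaled_perm => //; exists s^-1%g, 1%:M; split=> //.
  exists (const_mx 1); last by rewrite diag_const_mx.
  by apply/pos_mxE=> i j; rewrite mxE.
rewrite mulmx1 -mulmxA [X in _ *m X]mulmxA -perm_mxM mulVg perm_mx1 mul1mx.
rewrite mulmx_diag -diag_const_mx; congr diag_mx; apply/rowP=> j.
by rewrite !mxE mulVf // gt_eqF.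
Qed.

Lemma scaled_perm_mx_nneg (R : realType) (r : nat) (P : 'M[R]_r) :
  scaled_perm_mx P -> P \is a mxOver Num.nneg.
Proof.
case=> s [_ [[d /pos_mxE d_gt0 ->] ->]].
apply/nneg_mxE => i j; rewrite mul_mx_diag !mxE mulr_ge0 ?ler0n //.
exact: ltW.
Qed.
(** * Rigidity in terms of the change of basis *)

(** Only the factorizations (A U, V B) with U V = 1 are compared with (A, B),
    so the neighborhood can be measured on the pair (U, V); the radius in
    these coordinates absorbs the norms of A and B. *)
Lemma locally_rigid_basis (R : realType) (m n r : nat)
    (A : 'M[R]_(m, r)) (B : 'M[R]_(r, n)) :
  locally_rigid A B -> exists2 e : R, 0 < e & forall U V : 'M[R]_r,
    U *m V = 1%:M -> `|U - 1%:M| < e -> `|V - 1%:M| < e ->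
    A *m U \is a mxOver Num.nneg -> V *m B \is a mxOver Num.nneg ->
    exists2 L, scaling_mx L & A *m U = A *m L.
Proof.
case=> _ [[NA NB] /= [/nbhs_ballP[a /= a_gt0 NAa] /nbhs_ballP[b /= b_gt0 NBb]]].
move=> rig.
pose K := r%:R * (`|A| + `|B|) + 1.
have K_gt0 : 0 < K by rewrite ltr_wpDl // mulr_ge0 // addr_ge0.
have small (x y : R) : y <= `|A| + `|B| -> 0 <= x -> x < Num.min a b / K ->
    r%:R * (y * x) < Num.min a b.
  move=> yAB x_ge0; rewrite ltr_pdivlMr // mulrC; apply: le_lt_trans.
  by rewrite mulrA ler_wpM2r // /K ler_wpDr // ler_wpM2l.
exists (Num.min a b / K) => [|U V UV1 U1 V1 AU_ge0 VB_ge0].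
  by rewrite divr_gt0 // lt_min a_gt0.
have NU : NA (A *m U).
  apply: NAa; rewrite mx_norm_ball /ball_ /= -{1}[A]mulmx1 -mulmxBr.
  apply: le_lt_trans (mx_norm_mulmx _ _) _.
  rewrite distrC; apply: lt_le_trans (small _ _ _ _ U1) _ => //.
    by rewrite lerDl.
  by rewrite ge_min lexx.
have NV : NB (V *m B).
  apply: NBb; rewrite mx_norm_ball /ball_ /= -{1}[B]mul1mx -mulmxBl.
  apply: le_lt_trans (mx_norm_mulmx _ _) _.
  rewrite distrC [X in _ * X]mulrC.
  apply: lt_le_trans (small _ _ _ _ V1) _ => //.
    by rewrite lerDr.
  by rewrite ge_min lexx orbT.
have [] := rig (A *m U, V *m B) (conj NU NV).
  by split=> //=; rewrite mulmxA -[A *m U *m V]mulmxA UV1 mulmx1.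
by move=> L [L_scal /= AUL _]; exists L.
Qed.

(** Comparing the four blocks of the two products: the corner C D = X2 Y2 makes
    S = C^-1 X2 and T = Y2 D^-1 mutually inverse, and the off-diagonal blocks
    then determine the rest of X and Y. *)
Lemma factorization_bordered (R : realType) (m n r : nat)
    (A : 'M[R]_(m, r)) (B : 'M[R]_(r, n)) (C D : 'M[R]_r)
    (X : 'M[R]_(m + r, r)) (Y : 'M[R]_(r, n + r)) :
  C \in unitmx -> D \in unitmx ->
  col_mx A C *m row_mx B D = X *m Y ->
  exists S T : 'M[R]_r,
    [/\ S *m T = 1%:M, X = col_mx A C *m S & Y = T *m row_mx B D].
Proof.
move=> uC uD; rewrite -[X]vsubmxK -[Y]hsubmxK !mul_col_row.
set X1 := usubmx X; set X2 := dsubmx X; set Y1 := lsubmx Y; set Y2 := rsubmx Y.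
case/eq_block_mx=> _ AD CB CD.
pose S := invmx C *m X2; pose T := Y2 *m invmx D.
have ST1 : S *m T = 1%:M.
  by rewrite /S /T mulmxA -[_ *m X2 *m _]mulmxA -CD mulKmx ?mulmxV.
have TS1 : T *m S = 1%:M by apply: mulmx1C.
exists S, T; split=> //.
  rewrite mul_col_mx mulKVmx // -[X1]mulmx1 -TS1 /T !mulmxA -AD.
  by rewrite mulmxK.
rewrite mul_mx_row mulmxKV // -[Y1]mul1mx -TS1 /S -!mulmxA -CB.
by rewrite mulKmx.
Qed.

(** * Near-nonnegative inverse pairs are near-permutations *)

(** The column sums of T = S^-1 are 1 like those of S, so the row sums t i of T
    are nonnegative with total r, and both S and T are bounded.  Hence every
    product S i k * T k j is at least -2 r eps.  For i != j these products
    sum to 0 over k, so they are also O(eps); for i = j they sum to 1, so some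
    k = f i has S i k * T k i >= 1/r.  For that k the entry T k i is bounded
    away from 0, which forces S j k = O(eps) for j != i: column f i of S is
    close to the i-th basis vector.  Closeness makes f injective. *)
Lemma stochastic_near_perm (R : realType) (r : nat) (eps : R)
    (S T : 'M[R]_r) :
  0 <= eps -> 8 * r%:R ^+ 4 * eps < 1 -> S *m T = 1%:M ->
  (forall j, \sum_i S i j = 1) ->
  (forall i j, - eps <= S i j) ->
  (forall i j, - (eps * \sum_k T i k) <= T i j) ->
  `|T| <= 2 * r%:R /\
  exists s : 'S_r, `|col_perm s S - 1%:M| <= 4 * r%:R ^+ 4 * eps.
Proof.
move=> eps_ge0 eps_small ST1 colS S_ge T_ge.
have [r0|r_gt0] := posnP r.
  subst r; split; first by apply: mx_norm_le => [|[]]; rewrite ?mulr_ge0.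
  by exists 1%g; apply: mx_norm_le => [|[]]; rewrite ?mulr_ge0 ?exprn_ge0.
set N : R := r%:R in eps_small *.
have N_ge1 : 1 <= N by rewrite ler1n.
have N_gt0 : 0 < N by apply: lt_le_trans N_ge1.
have N_ge0 := ltW N_gt0.
have powN k : (k <= 4)%N -> 8 * (N ^+ k * eps) < 1.
  move=> k4; apply: le_lt_trans eps_small.
  by rewrite mulrA ler_wpM2r // ler_wpM2l // ler_weXn2l.
have p0 := powN 0%N isT; have p1 := powN 1%N isT; rewrite expr0 expr1 in p0 p1.
pose t i := \sum_k T i k.
have t_ge0 i : 0 <= t i by apply: (sumr_ge0_relative eps_ge0); apply: T_ge.
have colT j : \sum_i T i j = 1.
  transitivity (\sum_i (S *m T) i j); last first.
    rewrite ST1 (bigD1 j) //= mxE eqxx big1 ?addr0 // => i /negPf ij.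
    by rewrite mxE ij.
  under [RHS]eq_bigr do rewrite mxE.
  rewrite exchange_big; apply: eq_bigr => k _ /=.
  by rewrite -mulr_suml colS mul1r.
have t_le i : t i <= N.
  have <- : \sum_i t i = N.
    by rewrite exchange_big /= (eq_bigr (fun=> 1)) // sumr_const card_ord.
  by rewrite (bigD1 i) //= lerDl sumr_ge0.
have T_le i j : T i j <= 2 * N.
  have := t_le i; have : T i j <= t i + N * (eps * t i).
    have -> : T i j = t i + \sum_(k < r | k != j) - T i k.
      by rewrite /t (bigD1 j) //= sumrN addrK.
    rewrite lerD2l; apply: sumr_ord_le => [|k _].
      by rewrite mulr_ge0 ?t_ge0.
    rewrite lerNl; exact: T_ge.
  have : N * eps * t i <= 1 * t i by rewrite ler_wpM2r //; move: p1; lra.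
  by rewrite mulrA; lra.
have S_le i j : S i j <= 2.
  have : S i j <= 1 + N * eps.
    have -> : S i j = 1 + \sum_(k < r | k != i) - S k j.
      by rewrite -(colS j) (bigD1 i) //= sumrN addrK.
    by rewrite lerD2l; apply: sumr_ord_le => // k _; rewrite lerNl.
  by move: p1; lra.
have T_geN i j : - (N * eps) <= T i j.
  apply: le_trans (T_ge i j); rewrite lerN2 mulrC ler_wpM2r //; exact: t_le.
split.
  apply: mx_norm_le => [|i j]; first by rewrite mulr_ge0.
  rewrite ler_norml T_le andbT; apply: le_trans (T_geN i j).
  by rewrite lerN2 mulrC; move: p1 N_ge1; lra.
have prod_ge i k j : - (2 * (N * eps)) <= S i k * T k j.
  have Neps_ge0 : 0 <= N * eps by rewrite mulr_ge0.
  have := S_ge i k; have := S_le i k; have := T_geN k j; have := T_le k j.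
  have [S_ge0|/ltW S_le0] := leP 0 (S i k).
    by move=> _ T_k S_i _; nra.
  have [T_ge0|/ltW T_le0] := leP 0 (T k j).
    by move=> T_k _ _ S_i; nra.
  have : 0 <= S i k * T k j by rewrite -mulrNN mulr_ge0 ?oppr_ge0.
  by move: Neps_ge0; lra.
have off i j k : i != j -> S i k * T k j <= N * (2 * (N * eps)).
  move=> /negPf ij; have := congr1 (fun M : 'M[R]_r => M i j) ST1.
  rewrite /= !mxE ij (bigD1 k) //= => /eqP; rewrite addr_eq0 => /eqP ->.
  rewrite -sumrN; apply: sumr_ord_le => [|l _]; last by rewrite lerNl.
  by rewrite !mulr_ge0.
have diag i : exists k, 1 <= N * (S i k * T k i).
  apply/not_existsP => no; have := congr1 (fun M : 'M[R]_r => M i i) ST1.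
  rewrite /= !mxE eqxx => ST1i.
  have : \sum_k S i k * T k i < \sum_(k < r) N^-1.
    apply: ltr_sum => [|k _].
      by apply/hasP; exists (Ordinal r_gt0); rewrite ?mem_index_enum.
    by rewrite -div1r ltr_pdivlMr // mulrC ltNge; apply/negP/no.
  rewrite ST1i sumr_const card_ord -[N^-1 *+ r]mulr_natl.
  by rewrite divff ?gt_eqF // ltxx.
have pivot i : exists k, forall j, `|S j k - (j == i)%:R| <= 4 * N ^+ 4 * eps.
  have [k piv] := diag i; exists k.
  (* otherwise both factors are nonpositive, with product at most r eps^2 *)
  have Tki_gt0 : 0 < T k i.
    rewrite ltNge; apply/negP => T_le0.
    have S_le0 : S i k <= 0.
      rewrite leNgt; apply/negP => S_gt0.
      have : N * (S i k * T k i) <= 0 by rewrite !pmulr_rle0.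
      by move: piv; lra.
    have : S i k * T k i <= eps * (N * eps).
      by rewrite -mulrNN ler_pM ?oppr_ge0 // lerNl.
    rewrite -(ler_pM2l N_gt0) => /(le_trans piv).
    have Neps_ge0 : 0 <= N * eps by rewrite mulr_ge0.
    by rewrite mulrA; move: p1; nra.
  have Tki : 1 <= N * (2 * T k i).
    apply: le_trans piv _; rewrite ler_pM2l // ler_pM2r //; exact: S_le.
  have Sjk j : j != i -> S j k <= 4 * N ^+ 3 * eps.
    move=> ji; rewrite -(ler_pM2r Tki_gt0); apply: le_trans (off _ _ k ji) _.
    have -> : 4 * N ^+ 3 * eps * T k i =
              N * (2 * (N * eps)) * (N * (2 * T k i)) by ring.
    by rewrite ler_peMr // !mulr_ge0.
  have c_ge0 : 0 <= 4 * N ^+ 3 * eps by rewrite !mulr_ge0 // exprn_ge0.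
  have cC : N * (4 * N ^+ 3 * eps) = 4 * N ^+ 4 * eps by ring.
  have off_norm j : j != i -> `|S j k| <= 4 * N ^+ 3 * eps.
    move=> ji; rewrite ler_norml Sjk // andbT; apply: le_trans (S_ge j k).
    by have N3_ge1 := exprn_ege1 3 N_ge1; rewrite lerN2 ler_peMl //; lra.
  move=> j; have [->|ji] := eqVneq j i; rewrite -cC; last first.
    by rewrite subr0; apply: le_trans (off_norm j ji) _; rewrite ler_peMl.
  have -> : S i k - 1 = - \sum_(j < r | j != i) S j k.
    by rewrite -(colS k) (bigD1 i) //= opprD addNKr.
  rewrite normrN; apply: le_trans (ler_norm_sum _ _ _) _; exact: sumr_ord_le.
have [f fP] := choice pivot.
have f_inj : injective f.
  move=> i i' ff; apply/eqP/negPn/negP => ii'.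
  have := fP i i; have := fP i' i; rewrite -ff eqxx (negPf ii').
  by rewrite !ler_norml => /andP[_ /= h1] /andP[h2 _]; lra.
exists (perm f_inj); apply: mx_norm_le => [|i j].
  by rewrite !mulr_ge0 // exprn_ge0.
by rewrite !mxE permE.
Qed.

(** Reduction to [stochastic_near_perm] by dividing the columns of S by their
    sums; the entry (i, j) of (1 + eps J) S is S i j + eps * (sum of column j),
    so the hypotheses are its relative lower bounds.  The matrix V, inverse
    to U, is only bounded here: that V is close to 1 follows from
    V - 1 = V (1 - U). *)
Lemma near_scaled_perm (R : realType) (r : nat) (eps : R) (S T : 'M[R]_r) :
  0 <= eps -> 8 * r%:R ^+ 4 * eps < 1 -> S *m T = 1%:M ->
  (1%:M + const_mx eps) *m S \is a mxOver Num.nneg ->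
  T *m (1%:M + const_mx eps) \is a mxOver Num.nneg ->
  exists U V P : 'M[R]_r,
    [/\ scaled_perm_mx P, U *m P = S, P *m T = V,
        `|U - 1%:M| <= 4 * r%:R ^+ 4 * eps
      & `|V| <= 2 * r%:R].
Proof.
move=> eps_ge0 eps_small ST1 /nneg_mxE CS_ge0 /nneg_mxE TD_ge0.
pose sigma j := \sum_i S i j.
have S_ge i j : - (eps * sigma j) <= S i j.
  have := CS_ge0 i j; rewrite mulmxDl mul1mx !mxE /sigma mulr_sumr.
  by under eq_bigr do rewrite mxE; rewrite -lerBlDr sub0r.
have T_ge i j : - (eps * \sum_k T i k) <= T i j.
  have := TD_ge0 i j; rewrite mulmxDr mulmx1 !mxE mulr_sumr.
  by under eq_bigr do rewrite mxE mulrC; rewrite -lerBlDr sub0r.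
have sigma_gt0 j : 0 < sigma j.
  rewrite lt_neqAle eq_sym; apply/andP; split.
    (* a zero column sum would make the column nonnegative, hence zero *)
    apply/eqP => sigma0.
    have Sj0 i : S i j = 0.
      apply: (@psumr_eq0P _ _ xpredT (S^~ j)) => // k _.
      by have := S_ge k j; rewrite sigma0 mulr0 oppr0.
    have := congr1 (fun M : 'M[R]_r => M j j) (mulmx1C ST1).
    rewrite !mxE eqxx big1 => [/esym/eqP|k _]; last by rewrite Sj0 mulr0.
    by rewrite oner_eq0.
  by apply: (sumr_ge0_relative eps_ge0) => i; apply: S_ge.
pose sg : 'rV[R]_r := \row_j sigma j.
pose sgV : 'rV[R]_r := \row_j (sigma j)^-1.
have sgVK : diag_mx sgV *m diag_mx sg = 1%:M.
  rewrite mulmx_diag -diag_const_mx; congr diag_mx; apply/rowP=> j.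
  by rewrite !mxE mulVf // gt_eqF.
pose S1 := S *m diag_mx sgV; pose T1 := diag_mx sg *m T.
have [||||] := @stochastic_near_perm R r eps S1 T1 eps_ge0 eps_small.
- by rewrite /S1 /T1 mulmxA -[_ *m _ *m diag_mx sg]mulmxA sgVK mulmx1.
- move=> j; rewrite /S1 mul_mx_diag; under eq_bigr do rewrite !mxE.
  by rewrite -mulr_suml -/(sigma j) divff // gt_eqF.
- move=> i j; rewrite /S1 mul_mx_diag !mxE ler_pdivlMr // mulNr; exact: S_ge.
- move=> i j; rewrite /T1 mul_diag_mx; under eq_bigr do rewrite !mxE.
  by rewrite -mulr_sumr !mxE mulrCA -mulrN ler_pM2l.
move=> T1_le [s S1_le].
exists (col_perm s S1), (perm_mx s *m T1), (perm_mx s *m diag_mx sg).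
split=> //.
- exists s, (diag_mx sg); split=> //; exists sg => //.
  by apply/pos_mxE => i j; rewrite mxE.
- rewrite col_permE mulmxA -[_ *m perm_mx _ *m perm_mx s]mulmxA -perm_mxM mulVg.
  by rewrite perm_mx1 mulmx1 -mulmxA sgVK mulmx1.
- by rewrite mulmxA.
- rewrite -row_permE; apply: mx_norm_le => [|i j]; first by rewrite mulr_ge0.
  by rewrite mxE; apply: le_trans T1_le; apply: norm_entry_le.
Qed.

(** As J^2 = r J, the inverse is 1 - eps / (1 + r eps) J. *)
Lemma perturbed_identity_unit (R : realType) (r : nat) (eps : R) :
  0 <= eps -> 1%:M + const_mx eps \in @unitmx R r.
Proof.
move=> eps_ge0; have d_gt0 : 0 < 1 + r%:R * eps by rewrite ltr_wpDr ?mulr_ge0.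
pose E : 'M[R]_r := const_mx eps.
have EE : E *m E = (r%:R * eps) *: E.
  apply/matrixP=> i j; rewrite !mxE.
  under eq_bigr do rewrite !mxE.
  by rewrite sumr_const card_ord -mulrA mulr_natl.
apply: (proj1 (@mulmx1_unit _ _ _
  (1%:M - (1 + r%:R * eps)^-1 *: E) _)); rewrite -/E.
rewrite mulmxDl mul1mx mulmxBr mulmx1 -scalemxAr EE scalerA.
apply/matrixP=> i j; rewrite !mxE; field; exact: lt0r_neq0.
Qed.

(** * The globally rigid extension *)

Theorem corollary4p7 (R : realType) (m n r : nat)
    (A : 'M[R]_(m, r)) (B : 'M[R]_(r, n))
    (m_gt0 : (0 < m)%N) (n_gt0 : (0 < n)%N) (r_gt0 : (0 < r)%N)
    (rigAB : locally_rigid A B) (rankAB : \rank (A *m B) = r) :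
  exists (k l : nat) (C : 'M[R]_(k, r)) (D : 'M[R]_(r, l)),
    [/\ (k <= r)%N, (l <= r)%N,
        C \is a mxOver Num.pos, D \is a mxOver Num.pos
      & globally_rigid (col_mx A C) (row_mx B D)].
Proof.
have [e e_gt0 rig] := locally_rigid_basis rigAB.
pose N : R := r%:R; have N_ge1 : 1 <= N by rewrite ler1n.
have N_gt0 : 0 < N by apply: lt_le_trans N_ge1.
(* U will be within 4 N^4 eps of 1, and V within N * (2 N) * (4 N^4 eps);
   with this eps both are at most e / 2 *)
pose eps := Num.min 1 e / (16 * N ^+ 6).
have d_gt0 : 0 < Num.min 1 e by rewrite lt_min ltr01.
have eps_gt0 : 0 < eps by rewrite divr_gt0 // mulr_gt0 // exprn_gt0.
have eps16 : 16 * N ^+ 6 * eps = Num.min 1 e.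
  by rewrite mulrC divfK // gt_eqF // mulr_gt0 // exprn_gt0.
have N46 : N ^+ 4 * eps <= N ^+ 6 * eps.
  by rewrite ler_pM2r // ler_weXn2l.
have eps1 : 8 * N ^+ 4 * eps < 1.
  have : Num.min 1 e <= 1 by rewrite ge_min lexx.
  have : 0 < N ^+ 4 * eps by rewrite mulr_gt0 // exprn_gt0.
  by move: eps16 N46; rewrite -!mulrA; lra.
have epse : 8 * N ^+ 6 * eps < e.
  have : Num.min 1 e <= e by rewrite ge_min lexx orbT.
  by move: eps16 d_gt0; lra.
pose C : 'M[R]_r := 1%:M + const_mx eps.
have C_gt0 : C \is a mxOver Num.pos.
  by apply/pos_mxE => i j; rewrite !mxE ltr_wpDl.
have uC : C \in unitmx by apply: perturbed_identity_unit; apply: ltW.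
exists r, r, C, C; split=> //.
have [[A_ge0 B_ge0 _] _] := rigAB.
split.
  split=> //; first by rewrite nneg_col_mx A_ge0 pos_mx_nneg.
  by rewrite nneg_row_mx B_ge0 pos_mx_nneg.
move=> X Y [X_ge0 Y_ge0 XY].
have [S [T [ST1 XS YT]]] := factorization_bordered uC uC (esym XY).
move: X_ge0 Y_ge0; rewrite XS YT mul_col_mx mul_mx_row.
rewrite nneg_col_mx nneg_row_mx.
move=> /andP[AS_ge0 CS_ge0] /andP[TB_ge0 TC_ge0].
have [U [V [P [P_perm UP PT U1 V_le]]]] :=
  near_scaled_perm (ltW eps_gt0) eps1 ST1 CS_ge0 TC_ge0.
have [Q Q_perm QP] := scaled_perm_mxV P_perm.
have PQ := mulmx1C QP.
have USQ : U = S *m Q by rewrite -UP -mulmxA PQ mulmx1.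
have UV1 : U *m V = 1%:M by rewrite -PT mulmxA UP.
have V1 : `|V - 1%:M| <= 8 * N ^+ 6 * eps.
  have -> : V - 1%:M = V *m (1%:M - U) by rewrite mulmxBr mulmx1 (mulmx1C UV1).
  apply: le_trans (mx_norm_mulmx _ _) _.
  have -> : 8 * N ^+ 6 * eps = N * (2 * N * (4 * N ^+ 4 * eps)) by ring.
  by rewrite ler_pM2l // ler_pM // distrC.
have [||||L L_scal AUL] := rig U V UV1.
- apply: le_lt_trans epse; apply: le_trans U1 _.
  have : 0 < N ^+ 4 * eps by rewrite mulr_gt0 // exprn_gt0.
  by move: N46; rewrite -!mulrA -/N; lra.
- exact: le_lt_trans epse.
- by rewrite USQ mulmxA mxOverM // scaled_perm_mx_nneg.
- by rewrite -PT -mulmxA mxOverM // scaled_perm_mx_nneg.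
have /row_full_inj A_inj : row_full A.
  by rewrite /row_full eqn_leq rank_leq_col -{1}rankAB mxrankM_maxl.
have UL := A_inj _ _ _ AUL.
have [uS _] := mulmx1_unit ST1.
have TE : T = invmx S by rewrite -[T](mulKmx uS) ST1 mulmx1.
exists S; split; rewrite ?mul_col_mx -?TE ?mul_mx_row //.
by rewrite -UP UL; apply: scaling_mul_scaled_perm.
Qed.
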